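(* Assume the sharpness condition: there is $\lambda_s>0$ with $F(x)-F(x_\star)\ge\lambda_s\Delta(x)$ for all $x\in\mathbb R^n$. Let $\tilde p\in(0,1)$ with $m\tilde p$ a positive integer, and let $u_L,u_H>0$ be constants such that $r^{\tilde p}(x)\in[u_L(F(x)-F(x_\star)),u_H(F(x)-F(x_\star))]$ for all $x\in\mathbb R^n$. Let $G>0$, $g_L:=G\lambda_su_L$, $g_H:=\frac32GL\|x_\star\|_2u_H$, and suppose $g_H\ge g_L\ge2/\lambda_s$. Consider AdaIPL (defined in the context) with step sizes $t_k=\min\{L^{-1},G\,r^{\tilde p}(x^k)\}$ and termination condition (HAC) for some $\rho_h\in(0,1/4)$, whose subproblems are solved by a subproblem solver with constant $C_0\ge2$ (defined in the context). Let $$M_0:=\frac{2+\sqrt2\,\rho_h^{3/4}/(1-2\rho_h^{1/2})}{1-\sqrt2\,\rho_h^{1/4}},\qquad M_2:=\sqrt{16\,C_0\,m\,B^2(\lambda_s/(4L))},$$ where $B(r):=\frac2m\|A\|_2(\|x_\star\|_2+r)\max_{i\in[m]}\|a_i\|_2$, and suppose $$\Delta(x^0)\le\min\Big\{\frac{\rho_h}{2Lg_L},\ \frac{\|x_\star\|_2}{\sqrt{M_0}},\ \frac1{g_HL}\Big\}.$$ Then for every $\epsilon\in(0,\Delta(x^0))$ the total number $N(\epsilon)$ of inner iterations satisfies $$N(\epsilon)\le M_2\cdot\frac{g_H\cdot\sqrt{\frac{1+\rho_h}{\rho_h}}\cdot\log\left(\frac{\lambda_s\Delta(x^0)g_L}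{6\rho_h}\cdot\frac1\epsilon\right)}{\log\big(\lambda_sg_L/(6\rho_h)\big)}.$$
   Context: Setting (robust phase retrieval): $a_1,\dots,a_m\in\mathbb R^n$, $A=[a_1,\dots,a_m]^\top\in\mathbb R^{m\times n}$, $x_\star\in\mathbb R^n$, and $b=(b_i)\in\mathbb R^m$, $b_i\ge0$, with $b_i=\langle a_i,x_\star\rangle^2$ for $i\in\mathcal I_1$ and $b_i$ an arbitrary non-negative number for $i\in\mathcal I_2$, where $\mathcal I_1,\mathcal I_2$ partition $[m]=\{1,\dots,m\}$. Define $F(x)=\frac1m\sum_{i=1}^m|\langle a_i,x\rangle^2-b_i|$, $L=2\|A\|_2^2/m$ ($\|A\|_2$ the spectral norm), $\Delta(x)=\min\{\|x-x_\star\|_2,\|x+x_\star\|_2\}$. Let $r_i(x)=|\langle a_i,x\rangle^2-b_i|$; $r^{\tilde p}(x)$ is the $(m\tilde p)$-th order statistic ($(m\tilde p)$-th smallest value, with multiplicity) of $r_1(x),\dots,r_m(x)$. Subproblem $k$: given $x^k$ and $t_k>0$, let $B_k=\frac2m\mathrm{diag}(Ax^k)A$, $d_k=\frac1m(b-|Ax^k|^2)$ ($|\cdot|^2$ entrywise), $H_k(z)=\frac1{2t_k}\|z\|_2^2+\|B_kz-d_k\|_1$ for $z\in\mathbb R^n$, and $D_k(\lambda)=-\frac{t_k}2\|B_k^\top\lambda\|_2^2-\lambda^\top d_k$ for $\lambda\in\mathbb R^m$, $\|\lambda\|_\infty\le1$ (the dual of minimizing $H_k$). Subproblem solver with constant $C_0\ge2$: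 a procedure that for each $k$ generates a sequence $(z^k_j,\lambda^k_j)_{j\ge0}\subset\mathbb R^n\times\mathbb R^m$ with $\sup_j\|\lambda^k_j\|_\infty\le1$ and $H_k(z^k_j)-D_k(\lambda^k_j)\le\frac{t_kC_0m\|B_k\|_2^2}{(j+1)^2}$ for all $j\ge1$. Termination condition (HAC) with parameter $\rho_h$ for a pair $(z,\lambda)$: $H_k(z)-D_k(\lambda)\le\frac{\rho_h}{2t_k}\|z\|_2^2$. AdaIPL with (HAC): from $x^0$, for $k=0,1,\dots$: compute $t_k$; run the solver on subproblem $k$ until the first $j\ge1$ at which $(z^k_j,\lambda^k_j)$ satisfies (HAC); call this index $N_k$, and set $x^{k+1}=x^k+z^k_{N_k}$. For $\epsilon>0$, $K_\epsilon=\inf\{k\ge1:\Delta(x^k)\le\epsilon\}$ and $N(\epsilon)=\sum_{k=0}^{K_\epsilon-1}N_k$ (only iterations before $K_\epsilon$ matter). *)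

(* Defs.v *)
From mathcomp Require Import all_boot all_order all_algebra.
From mathcomp Require Import all_classical all_reals all_analysis.
Import Order.TTheory GRing.Theory Num.Theory numFieldNormedType.Exports.

Set Implicit Arguments.
Unset Strict Implicit.
Unset Printing Implicit Defensive.

Local Open Scope ring_scope.

(* The norm `|v| that MathComp-Analysis puts on matrices is the entrywise sup
   norm; the Euclidean, l1 and spectral norms are therefore defined here. *)
Definition norm2 (R : realType) (n : nat) (v : 'cV[R]_n) : R :=
  Num.sqrt (\sum_(i < n) v i 0 ^+ 2).

Definition norm1 (R : realType) (n : nat) (v : 'cV[R]_n) : R :=
  \sum_(i < n) `|v i 0|.

Definition spectral_norm (R : realType) (m n : nat) (A : 'M[R]_(m, n)) : R :=
  sup [set norm2 (A *m z) | z in [set z : 'cV[R]_n | norm2 z <= 1]]%classic.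

(* The measurement vector a_i is the transpose of the i-th row of A, so that
   <a_i, x> is the entry (A *m x) i 0. *)
Definition max_row_norm (R : realType) (m n : nat) (A : 'M[R]_(m, n)) : R :=
  \big[Num.max/0]_(i < m) norm2 (row i A)^T.

Definition residual (R : realType) (m n : nat) (A : 'M[R]_(m, n))
    (b : 'cV[R]_m) (x : 'cV[R]_n) (i : 'I_m) : R :=
  `|(A *m x) i 0 ^+ 2 - b i 0|.

Definition loss (R : realType) (m n : nat) (A : 'M[R]_(m, n))
    (b : 'cV[R]_m) (x : 'cV[R]_n) : R :=
  m%:R^-1 * \sum_(i < m) residual A b x i.

Definition Lconst (R : realType) (m n : nat) (A : 'M[R]_(m, n)) : R :=
  2 * spectral_norm A ^+ 2 / m%:R.

Definition Delta (R : realType) (n : nat) (xs x : 'cV[R]_n) : R :=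
  Num.min (norm2 (x - xs)) (norm2 (x + xs)).

(* q-th smallest residual, q = 1, ..., m, counted with multiplicity. *)
Definition order_stat (R : realType) (m n : nat) (A : 'M[R]_(m, n))
    (b : 'cV[R]_m) (q : nat) (x : 'cV[R]_n) : R :=
  nth 0 (sort <=%R [seq residual A b x i | i <- enum 'I_m]) q.-1.

Definition Bmat (R : realType) (m n : nat) (A : 'M[R]_(m, n))
    (x : 'cV[R]_n) : 'M[R]_(m, n) :=
  (2 / m%:R) *: (diag_mx (A *m x)^T *m A).

Definition dvec (R : realType) (m n : nat) (A : 'M[R]_(m, n))
    (b : 'cV[R]_m) (x : 'cV[R]_n) : 'cV[R]_m :=
  m%:R^-1 *: \col_(i < m) (b i 0 - `|(A *m x) i 0| ^+ 2).

Definition primal (R : realType) (m n : nat) (A : 'M[R]_(m, n))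
    (b : 'cV[R]_m) (x : 'cV[R]_n) (t : R) (z : 'cV[R]_n) : R :=
  (2 * t)^-1 * norm2 z ^+ 2 + norm1 (Bmat A x *m z - dvec A b x).

Definition dual (R : realType) (m n : nat) (A : 'M[R]_(m, n))
    (b : 'cV[R]_m) (x : 'cV[R]_n) (t : R) (lam : 'cV[R]_m) : R :=
  - (t / 2) * norm2 ((Bmat A x)^T *m lam) ^+ 2
  - (lam^T *m dvec A b x) 0 0.

Definition gap (R : realType) (m n : nat) (A : 'M[R]_(m, n))
    (b : 'cV[R]_m) (x : 'cV[R]_n) (t : R) (z : 'cV[R]_n) (lam : 'cV[R]_m) : R :=
  primal A b x t z - dual A b x t lam.

Definition HAC (R : realType) (m n : nat) (A : 'M[R]_(m, n)) (b : 'cV[R]_m)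
    (rho : R) (x : 'cV[R]_n) (t : R) (z : 'cV[R]_n) (lam : 'cV[R]_m) : Prop :=
  gap A b x t z lam <= rho / (2 * t) * norm2 z ^+ 2.

(* z j and lam j, j >= 0, are the iterates produced by a subproblem solver with
   constant C0 on the subproblem with center x and step size t. *)
Definition solver_output (R : realType) (m n : nat) (A : 'M[R]_(m, n))
    (b : 'cV[R]_m) (C0 : R) (x : 'cV[R]_n) (t : R)
    (z : nat -> 'cV[R]_n) (lam : nat -> 'cV[R]_m) : Prop :=
  (forall j, `|lam j| <= 1) /\
  (forall j, (1 <= j)%N ->
    gap A b x t (z j) (lam j)
      <= t * C0 * m%:R * spectral_norm (Bmat A x) ^+ 2 / j.+1%:R ^+ 2).

Definition first_index (P : nat -> Prop) (j : nat) : Prop :=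
  P j /\ forall i, (i < j)%N -> ~ P i.

Definition inner_count (R : realType) (m n : nat) (A : 'M[R]_(m, n))
    (b : 'cV[R]_m) (rho : R) (x : 'cV[R]_n) (t : R)
    (z : nat -> 'cV[R]_n) (lam : nat -> 'cV[R]_m) (N : nat) : Prop :=
  first_index (fun j => (1 <= j)%N /\ HAC A b rho x t (z j) (lam j)) N.

(* A run of AdaIPL with (HAC).  Subproblem k only makes sense when t k > 0, so
   nothing is required of the solver otherwise.  The next iterate is
   constrained only if the inner loop stops: its termination is not assumed. *)
Definition adaIPL_run (R : realType) (m n : nat) (A : 'M[R]_(m, n))
    (b : 'cV[R]_m) (C0 rho : R) (x : nat -> 'cV[R]_n) (t : nat -> R)
    (z : nat -> nat -> 'cV[R]_n) (lam : nat -> nat -> 'cV[R]_m) : Prop :=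
  forall k,
    (0 < t k -> solver_output A b C0 (x k) (t k) (z k) (lam k)) /\
    (forall N, inner_count A b rho (x k) (t k) (z k) (lam k) N ->
       x k.+1 = x k + z k N).

Definition hitting_time (R : realType) (n : nat) (xs : 'cV[R]_n)
    (x : nat -> 'cV[R]_n) (eps : R) (K : nat) : Prop :=
  first_index (fun k => (1 <= k)%N /\ Delta xs (x k) <= eps) K.

(* N(eps) is finite and bounded by c: the outer hitting time K_eps and all the
   inner counts N_k, k < K_eps, exist (they are unique by minimality), and
   their sum is at most c. *)
Definition total_inner_le (R : realType) (m n : nat) (A : 'M[R]_(m, n))
    (b : 'cV[R]_m) (rho : R) (xs : 'cV[R]_n) (x : nat -> 'cV[R]_n)
    (t : nat -> R) (z : nat -> nat -> 'cV[R]_n)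
    (lam : nat -> nat -> 'cV[R]_m) (eps c : R) : Prop :=
  exists (K : nat) (N : nat -> nat),
    [/\ hitting_time xs x eps K,
        forall k, (k < K)%N ->
          inner_count A b rho (x k) (t k) (z k) (lam k) (N k)
      & (\sum_(k < K) N k)%N%:R <= c].

Definition M0const (R : realType) (rho : R) : R :=
  (2 + Num.sqrt 2 * rho `^ (3 / 4) / (1 - 2 * rho `^ (1 / 2)))
    / (1 - Num.sqrt 2 * rho `^ (1 / 4)).

Definition Bfun (R : realType) (m n : nat) (A : 'M[R]_(m, n))
    (xs : 'cV[R]_n) (r : R) : R :=
  2 / m%:R * spectral_norm A * (norm2 xs + r) * max_row_norm A.

Definition M2const (R : realType) (m n : nat) (A : 'M[R]_(m, n))
    (xs : 'cV[R]_n) (C0 lambda_s : R) : R :=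
  Num.sqrt (16 * C0 * m%:R * Bfun A xs (lambda_s / (4 * Lconst A)) ^+ 2).

(* Main.v *)
Require Import Defs.
From mathcomp Require Import all_boot all_order all_algebra.
From mathcomp Require Import all_classical all_reals all_analysis.
From mathcomp Require Import ring lra.
Import Order.TTheory GRing.Theory Num.Theory numFieldNormedType.Exports.
Local Open Scope ring_scope.

(* Write D for Delta(x^k) and y for the nearest of the two solutions +-xs.  Weak
   duality with its quadratic remainder shows that a dual point lam certifies
   closeness of z to w = - t B^T lam, and that the step z satisfies
     F(x + z) - F(y) <= (|y - x|^2 - |z|^2 - |y - x - w|^2) / (2t) + gap
                        + L/2 (|y - x|^2 + |z|^2).
   The step size obeys g_L D <= t <= min(g_H D, 1/L).  If (HAC) holds, the M0
   hypothesis keeps x + z nearest to y, and sharpness turns the inequality into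
   Delta(x + z) <= 6 rho / (lambda_s g_L) D; the loss of 1/g_L <= lambda_s/2 to
   the term (|y - x|^2 - |z|^2) / (2t) is where 2/lambda_s <= g_L enters.  If
   (HAC) fails, then gap >= rho t / (16 g_H^2 (1 + rho)): otherwise z would be
   too short for the same inequality to be compatible with
   Delta(x + z) >= D - |z|.  Comparing with the O(1/j^2) rate of the solver
   bounds every inner count by the same number. *)

Set Implicit Arguments.
Unset Strict Implicit.

(** * Scalar inequalities behind one step *)

(* Used with D = |y - x|, u = |x + z - y|, zeta = |z|, e = |y - x - w|,
   c = sqrt 2 and v = rho^(1/4); the resulting constant is M0. *)
Lemma quadratic_error_bound (R : realFieldType) (c v D u zeta e : R) :
  0 < c -> c ^+ 2 = 2 -> 0 < v -> v ^+ 4 < 1 / 4 ->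
  0 <= D -> 0 <= u -> 0 <= zeta -> 0 <= e ->
  zeta <= u + D -> u <= e + v ^+ 2 * zeta ->
  e ^+ 2 <= 2 * D ^+ 2 + v ^+ 4 * zeta ^+ 2 ->
  (1 - c * v) * u ^+ 2 <= (2 + c * v ^+ 3 / (1 - 2 * v ^+ 2)) * D ^+ 2.
Proof.
move=> c0 c2 v0 v4 D0 u0 z0 e0 hz hu he.
have v2 : v ^+ 2 < 1 / 2 by nra.
have r1 : c * v < 1.
  have: (c * v) ^+ 2 < 1 by rewrite exprMn c2; lra.
  nra.
have hd : 0 < 1 - 2 * v ^+ 2 by lra.
(* Squaring u - v^2 zeta <= e makes v^4 zeta^2 cancel against [he]; then zeta <= u + D eliminates
   zeta. If u - v^2 zeta is negative, u^2 <= v^2 zeta u suffices. *)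
have hq : (1 - 2 * v ^+ 2) * u ^+ 2 <= 2 * v ^+ 2 * u * D + 2 * D ^+ 2.
  have v20 : 0 <= v ^+ 2 by nra.
  have h1 : v ^+ 2 * u * zeta <= v ^+ 2 * u * (u + D).
    by rewrite ler_wpM2l // mulr_ge0.
  have h2 : u ^+ 2 - 2 * (v ^+ 2 * u * zeta) + v ^+ 4 * zeta ^+ 2 <= e ^+ 2
      \/ u <= v ^+ 2 * zeta.
    have [h|h] := lerP u (v ^+ 2 * zeta); [by right|left].
    have : (u - v ^+ 2 * zeta) ^+ 2 <= e ^+ 2 by nra.
    apply: le_trans; rewrite le_eqVlt; apply/orP; left; apply/eqP; ring.
  case: h2 => h2; first by nra.
  have : u * u <= v ^+ 2 * zeta * u by rewrite ler_wpM2r.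
  nra.
set r := c * v.
have -> : c * v ^+ 3 = r ^+ 3 / 2 by rewrite /r exprMn (exprS c) c2; field.
have r2 : 2 * v ^+ 2 = r ^+ 2 by rewrite /r exprMn c2.
rewrite r2 in hq hd *.
have r0 : 0 < r by rewrite mulr_gt0.
rewrite -subr_ge0.
(* The last square absorbs the cross term u D of [hq]; the u^2 terms then add up to exactly -(1 - r)
   u^2. *)
have -> : (2 + r ^+ 3 / 2 / (1 - r ^+ 2)) * D ^+ 2 - (1 - r) * u ^+ 2 =
  (2 * D ^+ 2 + r ^+ 2 * u * D - (1 - r ^+ 2) * u ^+ 2) +
  r * (1 - r) ^+ 2 / 2 * u ^+ 2 +
  r / (2 * (1 - r ^+ 2)) * ((1 - r ^+ 2) * u - r * D) ^+ 2.
  by field; rewrite gt_eqF.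
have h3 : 0 <= r * (1 - r) ^+ 2 / 2 * u ^+ 2 
  by rewrite mulr_ge0 ?sqr_ge0 // divr_ge0 // mulr_ge0 ?sqr_ge0 // ltW.
have h4 : 0 <= r / (2 * (1 - r ^+ 2)) * ((1 - r ^+ 2) * u - r * D) ^+ 2.
  by rewrite mulr_ge0 ?sqr_ge0 // divr_ge0 //; lra.
lra.
Qed.

(* All lengths are divided by D; s = sqrt rho, l = L D and tau = t / D. *)
Lemma contraction_normalized (R : realFieldType) (s lam g l tau u zeta e : R) :
  0 < s < 1 / 2 -> 0 < lam -> 0 < g -> 2 <= lam * g -> 0 <= l ->
  l * g <= s ^+ 2 / 2 -> g <= tau -> l * tau <= 1 ->
  0 <= u -> 0 <= zeta -> 0 <= e ->
  zeta <= u + 1 -> 1 <= u + zeta -> u <= e + s * zeta ->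
  lam * u <= (2 * tau)^-1 * (1 - zeta ^+ 2 + s ^+ 2 * zeta ^+ 2 - e ^+ 2)
             + l / 2 * (1 + zeta ^+ 2) ->
  lam * g * u <= 6 * s ^+ 2.
Proof.
move=> /andP[s0 s1] lam0 g0 k2 l0 lg gt lt1 u0 z0 e0 zu uz hu h.
have t0 : 0 < tau by lra.
set W := 1 - zeta ^+ 2 + s ^+ 2 * zeta ^+ 2 - e ^+ 2 in h.
have hW : 2 * tau * (lam * u) <= W + l * tau * (1 + zeta ^+ 2).
  have -> : W + l * tau * (1 + zeta ^+ 2) =
      2 * tau * ((2 * tau)^-1 * W + l / 2 * (1 + zeta ^+ 2)).
    by field; rewrite gt_eqF.
  by rewrite ler_pM2l //; lra.
(* A crude first bound on u, using only l tau <= 1, which makes zeta bounded. Small l g is exploited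
   afterwards. *)
have u34 : u <= 3 / 4.
  have h1 : 4 * u <= 2 * tau * (lam * u).
    have : lam * g * u <= lam * tau * u by rewrite ler_wpM2r // ler_wpM2l // ltW.
    have : 2 * u <= lam * g * u by rewrite ler_wpM2r.
    lra.
  have h2 : l * tau * (1 + zeta ^+ 2) <= 1 + zeta ^+ 2.
    by rewrite ler_piMl // addr_ge0 ?sqr_ge0.
  have h3 : e ^+ 2 + 4 * u <= 2 + s ^+ 2 * zeta ^+ 2 by rewrite /W in hW; lra.
  have [hs|hs] := lerP (s * zeta) u.
    have h5 : (u - s * zeta) ^+ 2 <= e ^+ 2 by nra.
    have h6 : u * (s * zeta) <= u * (s * (u + 1)) by rewrite ler_wpM2l // ler_wpM2l // ltW.
    have h7 : u * (s * (u + 1)) <= u * (1 / 2 * (u + 1)).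
      by rewrite ler_wpM2l // ler_wpM2r //; lra.
    nra.
  have h5 : s * zeta <= 1 / 2 * (u + 1) by nra.
  have h6 : (s * zeta) ^+ 2 <= (1 / 2 * (u + 1)) ^+ 2.
    by rewrite ler_pXn2r // nnegrE; nra.
  rewrite exprMn in h6.
  nra.
(* The value 11/3 produces the constant 6: s^2 (11/3) + (s^2 / 2) (1 + 11/3) = 6 s^2. *)
have z2 : zeta ^+ 2 <= 11 / 3 by nra.
have hlg : l * g * (1 + zeta ^+ 2) <= s ^+ 2 / 2 * (1 + zeta ^+ 2).
  by rewrite ler_wpM2r // addr_ge0 ?sqr_ge0.
have hs2 : s ^+ 2 * zeta ^+ 2 <= s ^+ 2 * (11 / 3) by rewrite ler_wpM2l ?sqr_ge0.
have hG : 2 * g * (lam * u) <= 2 * g * ((2 * tau)^-1 * W) + l * g * (1 + zeta ^+ 2).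
  have -> : 2 * g * ((2 * tau)^-1 * W) + l * g * (1 + zeta ^+ 2) =
     2 * g * ((2 * tau)^-1 * W + l / 2 * (1 + zeta ^+ 2)) by field; rewrite gt_eqF.
  by rewrite ler_pM2l //; lra.
have s20 : 0 < s ^+ 2 by rewrite exprn_gt0.
have [W0|W0] := lerP W 0.
  have : 2 * g * ((2 * tau)^-1 * W) <= 0.
    by rewrite mulr_ge0_le0 // ?mulr_ge0_le0 // ?invr_ge0; lra.
  lra.
have hgt : 2 * g * ((2 * tau)^-1 * W) <= W.
  by rewrite mulrA ler_piMl ?(ltW W0) // ler_pdivrMr; lra.
(* Since 2 u <= lam g u, half of the left side 2 lam g u of [hG] absorbs 1 - zeta^2, and only 6 s^2
   remains. *)
have z3 : 1 - zeta ^+ 2 <= 2 * u by nra.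
have e2 : 0 <= e ^+ 2 by exact: sqr_ge0.
have defW : W = 1 - zeta ^+ 2 + s ^+ 2 * zeta ^+ 2 - e ^+ 2 by [].
have : 2 * u <= lam * g * u by rewrite ler_wpM2r.
lra.
Qed.

(** * Euclidean inner product and norm *)

Definition dotv (R : realType) (n : nat) (u v : 'cV[R]_n) : R :=
  \sum_(i < n) u i 0 * v i 0.

Lemma norm2_ge0 (R : realType) (n : nat) (v : 'cV[R]_n) : 0 <= norm2 v.
Proof. exact: sqrtr_ge0. Qed.

Lemma sqr_norm2 (R : realType) (n : nat) (v : 'cV[R]_n) :
  norm2 v ^+ 2 = dotv v v.
Proof.
rewrite sqr_sqrtr; first by apply: eq_bigr => i _; rewrite expr2.
by apply: sumr_ge0 => i _; exact: sqr_ge0.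
Qed.

Lemma dotvC (R : realType) (n : nat) (u v : 'cV[R]_n) : dotv u v = dotv v u.
Proof. by apply: eq_bigr => i _; rewrite mulrC. Qed.

Lemma dotvDl (R : realType) (n : nat) (u v w : 'cV[R]_n) :
  dotv (u + v) w = dotv u w + dotv v w.
Proof. by rewrite -big_split; apply: eq_bigr => i _; rewrite mxE mulrDl. Qed.

Lemma dotvZl (R : realType) (n : nat) (a : R) (u v : 'cV[R]_n) :
  dotv (a *: u) v = a * dotv u v.
Proof. by rewrite mulr_sumr; apply: eq_bigr => i _; rewrite mxE mulrA. Qed.

Lemma dotvDr (R : realType) (n : nat) (u v w : 'cV[R]_n) :
  dotv w (u + v) = dotv w u + dotv w v.
Proof. by rewrite !(dotvC w) dotvDl. Qed.

Lemma dotvZr (R : realType) (n : nat) (a : R) (u v : 'cV[R]_n) :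
  dotv u (a *: v) = a * dotv u v.
Proof. by rewrite !(dotvC u) dotvZl. Qed.

Lemma sqr_norm2D (R : realType) (n : nat) (u v : 'cV[R]_n) :
  norm2 (u + v) ^+ 2 = norm2 u ^+ 2 + 2 * dotv u v + norm2 v ^+ 2.
Proof.
by rewrite !sqr_norm2 dotvDl !dotvDr (dotvC v u); ring.
Qed.

Lemma norm2Z (R : realType) (n : nat) (a : R) (v : 'cV[R]_n) :
  norm2 (a *: v) = `|a| * norm2 v.
Proof.
apply/eqP; rewrite -(@eqrXn2 _ 2) ?norm2_ge0 ?mulr_ge0 ?norm2_ge0 //.
by rewrite exprMn !sqr_norm2 dotvZl dotvZr mulrA real_normK ?num_real.
Qed.

Lemma norm2N (R : realType) (n : nat) (v : 'cV[R]_n) : norm2 (- v) = norm2 v.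
Proof. by rewrite -scaleN1r norm2Z normrN1 mul1r. Qed.

(** Cauchy-Schwarz, by expanding the square of |v| u - |u| v. This gives the claim multiplied by |u|
    |v|, so a vanishing norm is treated apart. *)
Lemma dotv_le (R : realType) (n : nat) (u v : 'cV[R]_n) :
  dotv u v <= norm2 u * norm2 v.
Proof.
have u0 := norm2_ge0 u; have v0 := norm2_ge0 v.
have h : 0 <= norm2 (norm2 v *: u + (- norm2 u) *: v) ^+ 2 by exact: sqr_ge0.
rewrite sqr_norm2D !norm2Z normrN !ger0_norm // dotvZl dotvZr in h.
have {}h : norm2 u * norm2 v * dotv u v <= norm2 u * norm2 v * (norm2 u * norm2 v).
  by nra.
have := mulr_ge0 u0 v0; rewrite le_eqVlt => /orP[/eqP e|e]; last first.
  by rewrite -(ler_pM2l e).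
have eq0 (w : 'cV[R]_n) : norm2 w = 0 -> forall i, w i 0 = 0.
  move=> w0 i; apply/eqP; rewrite -sqrf_eq0.
  have /eqP := sqr_norm2 w; rewrite w0 expr0n /= eq_sym psumr_eq0.
    by move/allP => /(_ i); rewrite mem_index_enum expr2 => /(_ isT).
  by move=> j _; rewrite -expr2 sqr_ge0.
rewrite -e le_eqVlt; apply/orP; left; apply/eqP.
have /eqP := esym e; rewrite mulf_eq0 => /orP[/eqP/eq0 w0|/eqP/eq0 w0];
  by apply: big1 => i _; rewrite w0 ?mul0r ?mulr0.
Qed.

Lemma norm2D (R : realType) (n : nat) (u v : 'cV[R]_n) :
  norm2 (u + v) <= norm2 u + norm2 v.
Proof.
rewrite -(@ler_pXn2r _ 2) // ?nnegrE ?addr_ge0 ?norm2_ge0 //.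
rewrite sqr_norm2D; have := dotv_le u v; nra.
Qed.

Lemma norm2B_le (R : realType) (n : nat) (u v : 'cV[R]_n) :
  norm2 (u - v) <= norm2 u + norm2 v.
Proof. by rewrite -(norm2N v); exact: norm2D. Qed.

Lemma normr_dotv_le (R : realType) (n : nat) (u v : 'cV[R]_n) :
  `|dotv u v| <= norm2 u * norm2 v.
Proof.
rewrite ler_norml dotv_le andbT lerNl -mulN1r -dotvZl scaleN1r.
by rewrite -(norm2N u) dotv_le.
Qed.

(** * Row norms and the spectral norm *)

Lemma mulmx_dotv (R : realType) (m n : nat) (A : 'M[R]_(m, n)) (z : 'cV[R]_n) i :
  (A *m z) i 0 = dotv (row i A)^T z.
Proof. by rewrite mxE; apply: eq_bigr => j _; rewrite !mxE. Qed.

Lemma row_norm_le_max (R : realType) (m n : nat) (A : 'M[R]_(m, n)) i :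
  norm2 (row i A)^T <= max_row_norm A.
Proof. exact: (le_bigmax (0 : R) (fun i => norm2 (row i A)^T)). Qed.

Lemma max_row_norm_ge0 (R : realType) (m n : nat) (A : 'M[R]_(m, n)) :
  0 <= max_row_norm A.
Proof. exact: bigmax_ge_id. Qed.

Lemma mulmx_entry_le (R : realType) (m n : nat) (A : 'M[R]_(m, n))
    (z : 'cV[R]_n) i :
  `|(A *m z) i 0| <= max_row_norm A * norm2 z.
Proof.
rewrite mulmx_dotv; apply: le_trans (normr_dotv_le _ _) _.
by rewrite ler_wpM2r ?norm2_ge0 ?row_norm_le_max.
Qed.

(** Shows that the set whose [sup] is the spectral norm is bounded above, and later compares that
    norm with the largest row norm. *)
Lemma norm2_mulmx_row_le (R : realType) (m n : nat) (A : 'M[R]_(m, n))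
    (z : 'cV[R]_n) :
  norm2 (A *m z) <= Num.sqrt m%:R * max_row_norm A * norm2 z.
Proof.
have M0 := max_row_norm_ge0 A; have z0 := norm2_ge0 z.
rewrite -(@ler_pXn2r _ 2) // ?nnegrE ?mulr_ge0 ?norm2_ge0 ?sqrtr_ge0 //.
rewrite sqr_norm2 -mulrA exprMn sqr_sqrtr ?ler0n //.
have -> : m%:R * (max_row_norm A * norm2 z) ^+ 2 =
    \sum_(i < m) (max_row_norm A * norm2 z) ^+ 2.
  by rewrite sumr_const card_ord mulr_natl.
apply: ler_sum => i _; rewrite -expr2 -real_normK ?num_real //.
by rewrite ler_pXn2r ?nnegrE ?normr_ge0 ?mulr_ge0 // mulmx_entry_le.
Qed.

Lemma spectral_norm_le (R : realType) (m n : nat) (A : 'M[R]_(m, n)) (c : R) :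
  0 <= c -> (forall z, norm2 (A *m z) <= c * norm2 z) -> spectral_norm A <= c.
Proof.
move=> c0 h; apply: ge_sup.
  exists (norm2 (A *m 0)); exists 0 => //=.
  by rewrite -[0 : 'cV_n](scale0r 0) norm2Z normr0 mul0r.
move=> _ [z /= z1 <-]; apply: le_trans (h z) _.
by rewrite ler_piMr.
Qed.

Lemma norm2_mulmx_le (R : realType) (m n : nat) (A : 'M[R]_(m, n))
    (z : 'cV[R]_n) :
  norm2 (A *m z) <= spectral_norm A * norm2 z.
Proof.
have M0 := max_row_norm_ge0 A.
have hub : has_ubound [set norm2 (A *m z) | z in [set z : 'cV[R]_n | norm2 z <= 1]]%classic.
  exists (Num.sqrt m%:R * max_row_norm A) => _ [w /= w1 <-].
  apply: le_trans (norm2_mulmx_row_le A w) _.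
  by rewrite ler_piMr // mulr_ge0 ?sqrtr_ge0.
have := norm2_ge0 z; rewrite le_eqVlt => /orP[/eqP e|z0].
  by have := norm2_mulmx_row_le A z; rewrite -e !mulr0.
rewrite -ler_pdivrMr //.
have -> : norm2 (A *m z) / norm2 z = norm2 (A *m ((norm2 z)^-1 *: z)).
  by rewrite -scalemxAr norm2Z ger0_norm ?invr_ge0 ?norm2_ge0 // mulrC.
apply: ub_le_sup => //; exists ((norm2 z)^-1 *: z) => //=.
by rewrite norm2Z ger0_norm ?invr_ge0 ?norm2_ge0 // mulVf ?gt_eqF.
Qed.

Lemma spectral_norm_ge0 (R : realType) (m n : nat) (A : 'M[R]_(m, n)) :
  0 <= spectral_norm A.
Proof.
have M0 := max_row_norm_ge0 A.
have hub : has_ubound [set norm2 (A *m z) | z in [set z : 'cV[R]_n | norm2 z <= 1]]%classic.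
  exists (Num.sqrt m%:R * max_row_norm A) => _ [w /= w1 <-].
  apply: le_trans (norm2_mulmx_row_le A w) _.
  by rewrite ler_piMr // mulr_ge0 ?sqrtr_ge0.
apply: le_trans (norm2_ge0 (A *m 0)) _.
apply: ub_le_sup => //; exists 0 => //=.
by rewrite -[0 : 'cV_n](scale0r 0) norm2Z normr0 mul0r.
Qed.

Lemma spectral_norm_le_row (R : realType) (m n : nat) (A : 'M[R]_(m, n)) :
  spectral_norm A <= Num.sqrt m%:R * max_row_norm A.
Proof.
apply: spectral_norm_le => [|z]; last exact: norm2_mulmx_row_le.
by rewrite mulr_ge0 ?sqrtr_ge0 ?max_row_norm_ge0.
Qed.

Lemma norm2_diag_mulmx_le (R : realType) (m : nat) (v w : 'cV[R]_m) (c : R) :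
  0 <= c -> (forall i, `|v i 0| <= c) ->
  norm2 (diag_mx v^T *m w) <= c * norm2 w.
Proof.
move=> c0 h.
rewrite -(@ler_pXn2r _ 2) // ?nnegrE ?mulr_ge0 ?norm2_ge0 //.
rewrite exprMn !sqr_norm2 mulr_sumr; apply: ler_sum => i _.
rewrite mul_diag_mx !mxE -!expr2 exprMn ler_wpM2r ?sqr_ge0 //.
by rewrite -real_normK ?num_real // ler_pXn2r ?nnegrE.
Qed.

(** In B = (2/m) diag(A x) A the diagonal factor has entries at most max |a_i| |x|, and the factor A
    contributes its spectral norm. *)
Lemma spectral_norm_Bmat_le (R : realType) (m n : nat) (A : 'M[R]_(m, n))
    (x : 'cV[R]_n) :
  spectral_norm (Bmat A x)
    <= 2 / m%:R * spectral_norm A * norm2 x * max_row_norm A.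
Proof.
have s0 := spectral_norm_ge0 A; have x0 := norm2_ge0 x.
have M0 := max_row_norm_ge0 A.
have m0 : 0 <= 2 / m%:R :> R by rewrite divr_ge0.
apply: spectral_norm_le => [|z]; first by rewrite !mulr_ge0.
rewrite /Bmat -scalemxAl norm2Z ger0_norm // -mulmxA.
have -> : 2 / m%:R * spectral_norm A * norm2 x * max_row_norm A * norm2 z =
  2 / m%:R * (max_row_norm A * norm2 x * (spectral_norm A * norm2 z)) by ring.
rewrite ler_wpM2l //.
apply: le_trans (norm2_diag_mulmx_le (A *m z) _ (fun i => mulmx_entry_le A x i)) _.
  by rewrite mulr_ge0.
by rewrite ler_wpM2l ?mulr_ge0 // norm2_mulmx_le.
Qed.

(** * Weak duality for the subproblem *)

Lemma dotvE (R : realType) (n : nat) (u v : 'cV[R]_n) :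
  dotv u v = (u^T *m v) 0 0.
Proof. by rewrite mxE; apply: eq_bigr => i _; rewrite mxE. Qed.

Lemma dotv_trmx (R : realType) (m n : nat) (B : 'M[R]_(m, n)) (w : 'cV[R]_n)
    (lam : 'cV[R]_m) :
  dotv w (B^T *m lam) = dotv lam (B *m w).
Proof. by rewrite [RHS]dotvC !dotvE trmx_mul mulmxA. Qed.

(** Hölder's inequality; the norm of [lam] is the entrywise sup norm, so every coordinate is at most
    1 in absolute value. *)
Lemma dotv_le_norm1 (R : realType) (m : nat) (lam v : 'cV[R]_m) :
  `|lam| <= 1 -> dotv lam v <= norm1 v.
Proof.
move=> lam1; apply: ler_sum => i _.
have li : `|lam i 0| <= 1.
  apply: le_trans lam1; rewrite -[leRHS]/(mx_norm lam) mx_normrE.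
  exact: (le_bigmax (0 : R) (fun ij => `|lam ij.1 ij.2|) (i, 0)).
apply: le_trans (ler_norm _) _; rewrite normrM.
by rewrite ler_piMl.
Qed.

(* The Lagrangian is strongly convex in the primal variable and minimal at
   [- t *: B^T lam], so weak duality holds with a quadratic remainder. *)
Lemma dual_le_primal (R : realType) (m n : nat) (A : 'M[R]_(m, n))
    (b : 'cV[R]_m) (x : 'cV[R]_n) (t : R) (w : 'cV[R]_n) (lam : 'cV[R]_m) :
  0 < t -> `|lam| <= 1 ->
  dual A b x t lam + (2 * t)^-1 * norm2 (w + t *: ((Bmat A x)^T *m lam)) ^+ 2
    <= primal A b x t w.
Proof.
move=> t0 lam1.
have h := dotv_le_norm1 (Bmat A x *m w - dvec A b x) lam1.
rewrite /primal; apply: le_trans (lerD (lexx _) h); rewrite /dual -dotvE.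
(* Once the l1 norm is replaced by its pairing with [lam], completing the square makes both sides
   equal. *)
rewrite sqr_norm2D norm2Z exprMn dotvZr dotv_trmx dotvDr -[- dvec A b x]scaleN1r (dotvZr (-1)).
rewrite real_normK ?num_real //.
rewrite le_eqVlt; apply/orP; left; apply/eqP; field.
by rewrite gt_eqF.
Qed.

(** * The loss, its linearized model and the descent inequality *)

Lemma sum_normM_le (R : realType) (n : nat) (u v : 'cV[R]_n) :
  \sum_(i < n) `|u i 0 * v i 0| <= norm2 u * norm2 v.
Proof.
pose a (w : 'cV[R]_n) : 'cV[R]_n := \col_i `|w i 0|.
have na w : norm2 (a w) = norm2 w.
  congr (Num.sqrt _); apply: eq_bigr => i _.
  by rewrite mxE real_normK ?num_real.
rewrite -(na u) -(na v); apply: le_trans (dotv_le _ _).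
by apply: ler_sum => i _; rewrite !mxE normrM.
Qed.

Lemma Lconst_ge0 (R : realType) (m n : nat) (A : 'M[R]_(m, n)) :
  0 <= Lconst A.
Proof. by rewrite divr_ge0 // mulr_ge0 ?sqr_ge0. Qed.

(** Cauchy-Schwarz for A u and A v, with L/2 = |A|^2 / m. It is the source of every factor L/2
    below. *)
Lemma mean_normM_le (R : realType) (m n : nat) (A : 'M[R]_(m, n))
    (u v : 'cV[R]_n) :
  m%:R^-1 * \sum_(i < m) `|(A *m u) i 0 * (A *m v) i 0|
    <= Lconst A / 2 * (norm2 u * norm2 v).
Proof.
have -> : Lconst A / 2 * (norm2 u * norm2 v) =
  m%:R^-1 * ((spectral_norm A * norm2 u) * (spectral_norm A * norm2 v)).
  by rewrite /Lconst; move: (m%:R^-1) => k; field.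
rewrite ler_wpM2l ?invr_ge0 //; apply: le_trans (sum_normM_le _ _) _.
by rewrite ler_pM ?norm2_ge0 // norm2_mulmx_le.
Qed.

(** Termwise, <a_i, x>^2 - <a_i, y>^2 factors as <a_i, x - y> <a_i, x + y>. *)
Lemma lossB_le (R : realType) (m n : nat) (A : 'M[R]_(m, n))
    (b : 'cV[R]_m) (x y : 'cV[R]_n) :
  loss A b x - loss A b y <= Lconst A / 2 * (norm2 (x - y) * norm2 (x + y)).
Proof.
apply: le_trans (mean_normM_le _ _ _).
rewrite /loss -mulrBr ler_wpM2l ?invr_ge0 // -sumrB; apply: ler_sum => i _.
rewrite /residual mulmxBr mulmxDr !mxE.
apply: le_trans (ler_norm _) _; apply: le_trans (ler_dist_dist _ _) _.
by rewrite le_eqVlt; apply/orP; left; apply/eqP; congr (_ _); ring.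
Qed.

(** The l1 term of the subproblem is the loss with each square linearized at x; the i-th square then
    differs by exactly <a_i, z>^2. *)
Lemma model_error (R : realType) (m n : nat) (A : 'M[R]_(m, n))
    (b : 'cV[R]_m) (x z : 'cV[R]_n) :
  `|loss A b (x + z) - norm1 (Bmat A x *m z - dvec A b x)|
    <= Lconst A / 2 * norm2 z ^+ 2.
Proof.
rewrite expr2; apply: le_trans (mean_normM_le _ _ _).
have -> : norm1 (Bmat A x *m z - dvec A b x) =
  m%:R^-1 * \sum_(i < m)
    `|2 * (A *m x) i 0 * (A *m z) i 0 + (A *m x) i 0 ^+ 2 - b i 0|.
  rewrite mulr_sumr; apply: eq_bigr => i _.
  rewrite -[m%:R^-1]ger0_norm ?invr_ge0 // -normrM.
  rewrite /Bmat -scalemxAl -mulmxA; congr (_ _).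
  rewrite mul_diag_mx /dvec; move: (A *m x) (A *m z) => ax az.
  rewrite !mxE real_normK ?num_real //.
  by ring.
rewrite -mulrBr normrM ger0_norm ?invr_ge0 // ler_wpM2l ?invr_ge0 //.
rewrite -sumrB; apply: le_trans (ler_norm_sum _ _ _) _.
apply: ler_sum => i _; apply: le_trans (ler_dist_dist _ _) _.
rewrite le_eqVlt; apply/orP; left; apply/eqP; congr (_ _).
by rewrite mulmxDr [in LHS]mxE; ring.
Qed.

(** The witness is w = - t B^T lam. [dual_le_primal] at z bounds |z - w|; at y - x it compares the
    gap at z with the model value at y. [model_error] at both points passes from the model to the
    loss. *)
Lemma step_descent (R : realType) (m n : nat) (A : 'M[R]_(m, n))
    (b : 'cV[R]_m) (x y : 'cV[R]_n) (t : R) (z : 'cV[R]_n) (lam : 'cV[R]_m) :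
  0 < t -> `|lam| <= 1 ->
  exists w : 'cV[R]_n,
    norm2 (z - w) ^+ 2 <= 2 * t * gap A b x t z lam /\
    loss A b (x + z) - loss A b y
      <= (2 * t)^-1 * (norm2 (y - x) ^+ 2 - norm2 z ^+ 2 - norm2 (y - x - w) ^+ 2)
         + gap A b x t z lam
         + Lconst A / 2 * (norm2 (y - x) ^+ 2 + norm2 z ^+ 2).
Proof.
move=> t0 lam1; exists (- (t *: ((Bmat A x)^T *m lam))); rewrite !opprK; split.
  have := dual_le_primal A b x z t0 lam1.
  by rewrite -lerBrDl ler_pdivrMl ?mulr_gt0.
have h1 := dual_le_primal A b x (y - x) t0 lam1.
have := model_error A b x (y - x); rewrite [x + _]addrC subrK ler_norml => /andP[h2 _].
have := model_error A b x z; rewrite ler_norml => /andP[_ h3].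
rewrite /gap /primal in h1 *.
lra.
Qed.

(** * Distance to the two solutions *)

Lemma DeltaN (R : realType) (n : nat) (xs x : 'cV[R]_n) :
  Delta (- xs) x = Delta xs x.
Proof. by rewrite /Delta opprK minC. Qed.

Lemma lossN (R : realType) (m n : nat) (A : 'M[R]_(m, n)) (b : 'cV[R]_m)
    (x : 'cV[R]_n) :
  loss A b (- x) = loss A b x.
Proof.
congr (_ * _); apply: eq_bigr => i _.
by rewrite /residual mulmxN [(- (A *m x)) i 0]mxE sqrrN.
Qed.

Lemma Delta_ge0 (R : realType) (n : nat) (xs x : 'cV[R]_n) : 0 <= Delta xs x.
Proof. by rewrite le_min !norm2_ge0. Qed.

Lemma Delta_attained (R : realType) (n : nat) (xs x : 'cV[R]_n) :
  exists2 y, y = xs \/ y = - xs & norm2 (y - x) = Delta xs x.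
Proof.
rewrite /Delta; case: (leP (norm2 (x - xs)) (norm2 (x + xs))) => _.
  by exists xs; [left | rewrite -norm2N opprB].
by exists (- xs); [right | rewrite -norm2N opprB opprK].
Qed.

Lemma Delta_lipschitz (R : realType) (n : nat) (xs x z : 'cV[R]_n) :
  Delta xs x <= Delta xs (x + z) + norm2 z.
Proof.
have h y : norm2 (x + y) <= norm2 (x + z + y) + norm2 z.
  have -> : x + y = (x + z + y) - z by rewrite (addrAC x z y) addrK.
  exact: norm2B_le.
rewrite -lerBlDr [leRHS]/Delta le_min !lerBlDr.
by apply/andP; split; (apply: le_trans (h _); rewrite ge_min lexx ?orbT).
Qed.

(** Apply [lossB_le] at the nearest solution y with x + y = (x - y) + 2 y. When Delta(x) <= |xs|
    this upper counterpart of sharpness is (3/2) L |xs| Delta(x), whence the 3/2 in g_H. *)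
Lemma loss_growth (R : realType) (m n : nat) (A : 'M[R]_(m, n)) (b : 'cV[R]_m)
    (xs x : 'cV[R]_n) :
  loss A b x - loss A b xs
    <= Lconst A / 2 * (Delta xs x * (2 * norm2 xs + Delta xs x)).
Proof.
have [y hy hD] := Delta_attained xs x.
have -> : loss A b xs = loss A b y by case: hy => ->; rewrite ?lossN.
have -> : norm2 xs = norm2 y by case: hy => ->; rewrite ?norm2N.
apply: le_trans (lossB_le _ _ _ _) _.
rewrite -hD -(norm2N (y - x)) opprB ler_wpM2l ?(divr_ge0 (Lconst_ge0 A)) //.
rewrite ler_wpM2l ?norm2_ge0 //.
have -> : x + y = (x - y) + 2 *: y by rewrite scaler_nat mulr2n addrA subrK.
by rewrite addrC; apply: le_trans (norm2D _ _) _; rewrite norm2Z ger0_norm.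
Qed.

(** * The constant M0 *)

Lemma M0constE (R : realType) (rho : R) (v := rho `^ (1 / 4)) : 0 < rho ->
  [/\ 0 < v, v ^+ 4 = rho &
   M0const rho = (2 + Num.sqrt 2 * v ^+ 3 / (1 - 2 * v ^+ 2))
                   / (1 - Num.sqrt 2 * v)].
Proof.
move=> rho0; have v0 : 0 < v by rewrite powR_gt0.
have vX k : v ^+ k = rho `^ (k%:R / 4).
  by rewrite -powR_mulrn ?ltW // /v -powRrM; congr (_ `^ _); field.
split=> //; first by rewrite vX divff ?pnatr_eq0 // powRr1 // ltW.
by rewrite /M0const !vX; congr ((2 + _ * _ / (1 - 2 * _ `^ _)) / _); field.
Qed.

(** All three follow from v^4 = rho < 1/4: the fourth power of sqrt 2 v is 4 rho < 1, and M0 has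
    numerator at least 2 and denominator at most 1. *)
Lemma M0const_bounds (R : realType) (rho : R) (v := rho `^ (1 / 4)) :
  0 < rho < 1 / 4 ->
  [/\ v ^+ 2 < 1 / 2, 0 < 1 - Num.sqrt 2 * v & 1 <= M0const rho].
Proof.
move=> /andP[rho0 rho1]; have [v0 v4 M0E] := M0constE rho0.
rewrite -/v in v0 v4 M0E.
have v21 : v ^+ 2 < 1 / 2.
  by rewrite -(@ltr_pXn2r _ 2) ?nnegrE ?sqr_ge0 // -exprM v4; lra.
have c0 : (0 : R) < Num.sqrt 2 by rewrite sqrtr_gt0.
have c2 : Num.sqrt 2 ^+ 2 = 2 :> R by rewrite sqr_sqrtr.
have cv0 : 0 <= Num.sqrt 2 * v by rewrite mulr_ge0 // ltW.
have cv1 : 0 < 1 - Num.sqrt 2 * v.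
  have hc : (Num.sqrt 2 * v) ^+ 4 < 1.
    by rewrite exprMn v4 (exprM _ 2 2) c2; lra.
  rewrite subr_gt0 ltNge; apply/negP => h.
  by move: hc; rewrite ltNge exprn_ege1.
split=> //; rewrite M0E ler_pdivlMr //.
have : 0 <= Num.sqrt 2 * v ^+ 3 / (1 - 2 * v ^+ 2).
  rewrite divr_ge0 //; first by rewrite mulr_ge0 ?exprn_ge0 // ltW.
  lra.
lra.
Qed.

(** * One outer step from a point whose nearest solution is [xs] *)

(** Writing 2 xs = (x + xs) - (x - xs) shows that |x + xs| is at least |xs|. *)
Lemma Delta_near (R : realType) (n : nat) (xs x : 'cV[R]_n) :
  norm2 (x - xs) <= norm2 xs -> Delta xs x = norm2 (x - xs).
Proof.
move=> h; apply: min_l.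
have : norm2 (2 *: xs) <= norm2 (x + xs) + norm2 (x - xs).
  have -> : 2 *: xs = (x + xs) - (x - xs).
    by rewrite scaler_nat mulr2n opprB [RHS]addrC addrA subrK.
  exact: norm2B_le.
rewrite norm2Z ger0_norm //; lra.
Qed.

(** Two passes over the same inequality: the first only locates x + z closer to [xs] than to its
    opposite, the second uses sharpness with Delta(x + z) = |x + z - xs|. *)
Lemma HAC_contraction_near (R : realType) (m n : nat) (A : 'M[R]_(m, n))
    (b : 'cV[R]_m) (xs x z : 'cV[R]_n) (t rho g_L lambda_s : R)
    (lam : 'cV[R]_m) :
  0 < lambda_s ->
  (forall x, lambda_s * Delta xs x <= loss A b x - loss A b xs) ->
  0 < g_L -> 2 <= lambda_s * g_L -> 0 < rho < 1 / 4 ->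
  0 < Delta xs x -> norm2 (xs - x) = Delta xs x ->
  Lconst A * Delta xs x * g_L <= rho / 2 ->
  Delta xs x <= norm2 xs / Num.sqrt (M0const rho) ->
  g_L * Delta xs x <= t -> Lconst A * t <= 1 ->
  `|lam| <= 1 -> HAC A b rho x t z lam ->
  lambda_s * g_L * Delta xs (x + z) <= 6 * rho * Delta xs x.
Proof.
move=> ls0 hsharp gL0 gL2 hrho D0 hD hD1 hD2 ht hLt lam1 hac.
have /andP[rho0 rho1] := hrho.
have t0 : 0 < t by apply: lt_le_trans ht; rewrite mulr_gt0.
have L0 := Lconst_ge0 A.
have [w [hw hdesc]] := step_descent A b x xs z t0 lam1.
rewrite hD in hdesc.
have hac' : gap A b x t z lam <= rho / (2 * t) * norm2 z ^+ 2 := hac.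
have [v0 v4 M0E] := M0constE rho0; have [s1 cv1 M01] := M0const_bounds hrho.
set v := rho `^ (1 / 4) in v0 v4 M0E s1 cv1.
set D := Delta xs x in D0 hD hD1 hD2 ht hdesc *.
set zeta := norm2 z in hdesc hac'; set e := norm2 (xs - x - w) in hdesc.
set u := norm2 (x + z - xs).
have z0 : 0 <= zeta := norm2_ge0 _; have u0 : 0 <= u := norm2_ge0 _.
have e0 : 0 <= e := norm2_ge0 _.
(* (HAC) bounds 2 t gap by rho zeta^2, and v^2 is the square root of rho. *)
have hzw : norm2 (z - w) <= v ^+ 2 * zeta.
  rewrite -(@ler_pXn2r _ 2) // ?nnegrE ?mulr_ge0 ?norm2_ge0 ?(ltW v0) //.
  apply: le_trans hw _; rewrite exprMn -exprM v4.
  apply: (@le_trans _ _ (2 * t * (rho / (2 * t) * zeta ^+ 2))).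
    by rewrite ler_wpM2l // mulr_ge0 // ltW.
  by rewrite le_eqVlt; apply/orP; left; apply/eqP; field; rewrite gt_eqF.
have zuD : zeta <= u + D.
  rewrite -hD /zeta; have -> : z = (x + z - xs) + (xs - x).
    by rewrite addrA subrK addrC addKr.
  exact: norm2D.
have Duz : D <= u + zeta.
  rewrite -hD [u + _]addrC; have -> : xs - x = z - (x + z - xs).
    by apply/matrixP => i j; rewrite !mxE; ring.
  exact: norm2B_le.
have uez : u <= e + v ^+ 2 * zeta.
  have -> : u = norm2 ((z - w) - (xs - x - w)).
    by congr norm2; apply/matrixP => i j; rewrite !mxE; ring.
  apply: le_trans (norm2B_le _ _) _. by rewrite -/e; lra.
have hF : loss A b (x + z) - loss A b xs
    <= (2 * t)^-1 * (D ^+ 2 - zeta ^+ 2 + rho * zeta ^+ 2 - e ^+ 2)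
       + Lconst A / 2 * (D ^+ 2 + zeta ^+ 2).
  apply: le_trans hdesc _.
  have e1 : rho / (2 * t) * zeta ^+ 2 = (2 * t)^-1 * (rho * zeta ^+ 2).
    by rewrite [RHS]mulrA (mulrC _ rho).
  rewrite e1 in hac'; lra.
(* First pass: sharpness serves only to make the loss difference nonnegative, and L t <= 1 bounds
   the curvature term. *)
have he : e ^+ 2 <= 2 * D ^+ 2 + v ^+ 4 * zeta ^+ 2.
  have h0 := le_trans (mulr_ge0 (ltW ls0) (Delta_ge0 xs (x + z)))
                      (le_trans (hsharp (x + z)) hF).
  have h1 : 0 <= D ^+ 2 - zeta ^+ 2 + rho * zeta ^+ 2 - e ^+ 2
                + Lconst A * t * (D ^+ 2 + zeta ^+ 2).
    have := mulr_ge0 (mulr_ge0 (ler0n R 2) (ltW t0)) h0.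
    congr (_ <= _); field; rewrite gt_eqF //.
  have h2 : Lconst A * t * (D ^+ 2 + zeta ^+ 2) <= D ^+ 2 + zeta ^+ 2.
    by rewrite ler_piMl // addr_ge0 ?sqr_ge0.
  rewrite v4; lra.
(* [quadratic_error_bound] yields u^2 <= M0 D^2, while [hD2] says D sqrt(M0) <= |xs|. *)
have huxs : u <= norm2 xs.
  have c0 : (0 : R) < Num.sqrt 2 by rewrite sqrtr_gt0.
  have c2 : Num.sqrt 2 ^+ 2 = 2 :> R by rewrite sqr_sqrtr.
  have hv : v ^+ 4 < 1 / 4 by rewrite v4.
  have := quadratic_error_bound c0 c2 v0 hv (ltW D0) u0 z0 e0 zuD uez he.
  rewrite mulrC -ler_pdivlMr // mulrAC -M0E => hu.
  have M00 : 0 < M0const rho := lt_le_trans ltr01 M01.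
  rewrite ler_pdivlMr ?sqrtr_gt0 // in hD2.
  apply: le_trans hD2.
  rewrite -(@ler_pXn2r _ 2) ?nnegrE ?mulr_ge0 ?sqrtr_ge0 ?(ltW D0) //.
  by rewrite exprMn (sqr_sqrtr (ltW M00)) [leRHS]mulrC.
have hDu : Delta xs (x + z) = u := Delta_near huxs.
have hls := le_trans (hsharp (x + z)) hF.
rewrite hDu in hls *.
have Dn0 : D != 0 by rewrite gt_eqF.
have s0 : 0 < v ^+ 2 by rewrite exprn_gt0.
have s01 : 0 < v ^+ 2 < 1 / 2 by rewrite s0.
have hc : lambda_s * g_L * (u / D) <= 6 * (v ^+ 2) ^+ 2.
  apply: (@contraction_normalized _ (v ^+ 2) lambda_s g_L (Lconst A * D) (t / D)
           (u / D) (zeta / D) (e / D)) => //.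
  - by rewrite mulr_ge0 // ltW.
  - by rewrite -exprM v4.
  - by rewrite ler_pdivlMr.
  - by have -> : Lconst A * D * (t / D) = Lconst A * t by field.
  - by rewrite divr_ge0 // ltW.
  - by rewrite divr_ge0 // ltW.
  - by rewrite divr_ge0 // ltW.
  - by rewrite ler_pdivrMr // mulrDl divfK // mul1r.
  - by rewrite -mulrDl ler_pdivlMr // mul1r.
  - by rewrite mulrA -mulrDl ler_pM2r ?invr_gt0.
  rewrite mulrA ler_pdivrMr //; apply: le_trans hls _.
  rewrite le_eqVlt; apply/orP; left; apply/eqP; rewrite -exprM v4; field.
  by rewrite Dn0 gt_eqF.
rewrite -exprM v4 in hc.
by rewrite mulrA ler_pdivrMr in hc.
Qed.

(** By contradiction: a smaller [gam] forces zeta <= (3/8) D, so the left side is at least (5/8) lam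
    D. The three terms on the right are at most lam D times 1/4, 1/128 and 1/16. *)
Lemma gap_lower_scalar (R : realFieldType) (L rho lam gL gH t gam D zeta e : R) :
  0 <= L -> 0 < rho < 1 / 4 -> 0 < lam -> 0 < gL -> gL <= gH -> 2 <= lam * gL ->
  0 < D -> L * D * gL <= rho / 2 -> gL * D <= t -> t <= gH * D ->
  0 <= zeta -> rho * zeta ^+ 2 < 2 * t * gam ->
  lam * (D - zeta) <= (2 * t)^-1 * (D ^+ 2 - zeta ^+ 2 - e ^+ 2) + gam
                      + L / 2 * (D ^+ 2 + zeta ^+ 2) ->
  rho * t <= 16 * gH ^+ 2 * (1 + rho) * gam.
Proof.
move=> L0 /andP[rho0 rho1] lam0 gL0 gLH k2 D0 hLD tl tu z0 hz h.
rewrite leNgt; apply/negP => hg.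
have t0 : 0 < t by apply: lt_le_trans tl; rewrite mulr_gt0.
have gH0 : 0 < gH by lra.
have gH0' := ltW gH0; have rho1' : 0 <= 1 + rho by lra.
have gam0 : 0 < gam.
  have : 0 < 2 * t * gam by apply: le_lt_trans hz; rewrite mulr_ge0 ?sqr_ge0 // ltW.
  by rewrite pmulr_rgt0 // mulr_gt0.
(* Chain zeta^2 < 2 t gam / rho with the negated bound on [gam] and t <= gH D; 2/16 gives the factor
   1/8. *)
have hz2 : 8 * zeta ^+ 2 <= D ^+ 2.
  have h1 : 16 * gH ^+ 2 * (1 + rho) * (rho * zeta ^+ 2) <= 2 * t * (rho * t).
    apply: (@le_trans _ _ (16 * gH ^+ 2 * (1 + rho) * (2 * t * gam))).
      by rewrite ler_wpM2l ?(ltW hz) // !mulr_ge0.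
    have -> : 16 * gH ^+ 2 * (1 + rho) * (2 * t * gam) =
      2 * t * (16 * gH ^+ 2 * (1 + rho) * gam) by ring.
    by rewrite ler_wpM2l ?(ltW hg) // mulr_ge0 // ltW.
  have h2 : 2 * rho * (8 * gH ^+ 2 * zeta ^+ 2 * (1 + rho)) <= 2 * rho * t ^+ 2 by lra.
  rewrite ler_pM2l ?mulr_gt0 // in h2.
  have h3 : 8 * gH ^+ 2 * zeta ^+ 2 <= 8 * gH ^+ 2 * zeta ^+ 2 * (1 + rho).
    rewrite ler_peMr ?mulr_ge0 ?sqr_ge0 //; lra.
  have h4 : t ^+ 2 <= (gH * D) ^+ 2.
    by rewrite ler_pXn2r // nnegrE ?mulr_ge0 // ltW.
  rewrite exprMn in h4.
  have : gH ^+ 2 * (8 * zeta ^+ 2) <= gH ^+ 2 * D ^+ 2 by lra.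
  by rewrite ler_pM2l ?exprn_gt0.
have zD : zeta <= 3 / 8 * D by nra.
have hgam : gam <= lam * D / 128.
  have h1 : gH * (16 * gH * gam) <= gH * (rho * D).
    have h2 : rho * t <= rho * (gH * D) by rewrite ler_wpM2l // ltW.
    have h3 : 16 * gH ^+ 2 * gam <= 16 * gH ^+ 2 * gam * (1 + rho).
      rewrite ler_peMr ?mulr_ge0 ?sqr_ge0 ?(ltW gam0) //; lra.
    rewrite expr2 in h3 hg; lra.
  rewrite ler_pM2l // in h1.
  have h2 : 2 * gam <= lam * gH * gam.
    rewrite ler_wpM2r ?(ltW gam0) //; apply: le_trans k2 _.
    by rewrite ler_wpM2l // ltW.
  have h3 : lam * (16 * gH * gam) <= lam * (1 / 4 * D).
    rewrite ler_wpM2l ?(ltW lam0) //; apply: le_trans h1 _.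
    by rewrite ler_wpM2r ?(ltW D0) // ltW.
  lra.
have h1 : (2 * t)^-1 * (D ^+ 2 - zeta ^+ 2 - e ^+ 2) <= lam * D / 4.
  rewrite ler_pdivrMl ?mulr_gt0 //.
  have h2 : D * (lam * gL * D) <= D * (lam * t).
    by rewrite ler_wpM2l ?(ltW D0) // -mulrA ler_wpM2l // ltW.
  have h3 : 2 * (D * D) <= lam * gL * (D * D) by rewrite ler_wpM2r // mulr_ge0 // ltW.
  have := sqr_ge0 zeta; have := sqr_ge0 e; rewrite (expr2 D); lra.
have h2 : L / 2 * (D ^+ 2 + zeta ^+ 2) <= lam * D / 16.
  have h3 : L / 2 * (D ^+ 2 + zeta ^+ 2) <= L / 2 * (2 * D ^+ 2).
    rewrite ler_wpM2l ?divr_ge0 //; have := sqr_ge0 zeta; lra.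
  have h4 : 2 * (L * D ^+ 2) <= lam * gL * (L * D ^+ 2).
    by rewrite ler_wpM2r // mulr_ge0 ?sqr_ge0.
  have h5 : lam * D * (L * D * gL) <= lam * D * (1 / 8).
    rewrite ler_wpM2l ?mulr_ge0 ?(ltW lam0) ?(ltW D0) //; lra.
  rewrite expr2 in h3 h4 *; lra.
have h3 : lam * zeta <= lam * (3 / 8 * D) by rewrite ler_wpM2l // ltW.
have h4 : 0 < lam * D by rewrite mulr_gt0.
lra.
Qed.

(** Sharpness at x + z is weakened to lambda_s (D - |z|), which is valid whichever solution is
    nearest to x + z. *)
Lemma gap_lower_near (R : realType) (m n : nat) (A : 'M[R]_(m, n))
    (b : 'cV[R]_m) (xs x z : 'cV[R]_n) (t rho g_L g_H lambda_s : R)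
    (lam : 'cV[R]_m) :
  0 < lambda_s ->
  (forall x, lambda_s * Delta xs x <= loss A b x - loss A b xs) ->
  0 < g_L -> g_L <= g_H -> 2 <= lambda_s * g_L -> 0 < rho < 1 / 4 ->
  0 < Delta xs x -> norm2 (xs - x) = Delta xs x ->
  Lconst A * Delta xs x * g_L <= rho / 2 ->
  g_L * Delta xs x <= t -> t <= g_H * Delta xs x ->
  `|lam| <= 1 -> ~ HAC A b rho x t z lam ->
  rho * t <= 16 * g_H ^+ 2 * (1 + rho) * gap A b x t z lam.
Proof.
move=> ls0 hsharp gL0 gLH gL2 hrho D0 hD hD1 tl tu lam1 /negP.
have t0 : 0 < t by apply: lt_le_trans tl; rewrite mulr_gt0.
rewrite -ltNge => hac.
have [w [_ hdesc]] := step_descent A b x xs z t0 lam1.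
rewrite hD in hdesc.
apply: (@gap_lower_scalar _ (Lconst A) rho lambda_s g_L g_H t _ (Delta xs x)
  (norm2 z) (norm2 (xs - x - w))) => //.
- exact: Lconst_ge0.
- exact: norm2_ge0.
- have -> : rho * norm2 z ^+ 2 = 2 * t * (rho / (2 * t) * norm2 z ^+ 2).
    by field; rewrite gt_eqF.
  by rewrite ltr_pM2l ?mulr_gt0.
apply: le_trans hdesc; apply: le_trans (hsharp _).
by rewrite ler_pM2l // lerBlDr Delta_lipschitz.
Qed.

(** * Counting iterations: stopping indices and geometric decay *)

(** Failure through j forces j + 1 <= T, so failure cannot persist. A least index N >= 2 is bounded
    by taking j = N - 1; N = 1 is covered by 1 <= T. *)
Lemma first_index_le (R : realType) (P : nat -> Prop) (T : R) :
  1 <= T ->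
  (forall j, (1 <= j)%N -> (forall i, (1 <= i <= j)%N -> ~ P i) ->
     j.+1%:R <= T) ->
  exists N, first_index (fun j => (1 <= j)%N /\ P j) N /\ N%:R <= T.
Proof.
move=> T1 hT.
pose Q j := `[< (1 <= j)%N /\ P j >].
have exQ : exists j, Q j.
  apply: contrapT => noQ.
  have noP i : (1 <= i)%N -> ~ P i.
    by move=> i1 Pi; apply: noQ; exists i; apply/asboolP.
  pose j := (Num.trunc T).+1.
  have : j.+1%:R <= T by apply: hT => // i /andP[i1 _]; exact: noP.
  rewrite leNgt => /negP; apply; apply: lt_le_trans (truncnS_gt T) _.
  by rewrite ler_nat.
case: (ex_minnP exQ) => N /asboolP[N1 PN] minN.
have notP i : (i < N)%N -> ~ ((1 <= i)%N /\ P i).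
  move=> iN hi; have := minN i; rewrite leqNgt iN => h.
  by have := h (introT (asboolP _) hi).
exists N; split; first by split.
case: N N1 PN minN notP => [//|[|N]] _ _ _ notP; first by [].
apply: hT => // i /andP[i1 iN] Pi.
exact: (notP i).
Qed.

(** Staying above eps for j steps forces eps < theta^j d(0), which bounds j by a quotient of
    logarithms; the stopping index adds 1. *)
Lemma hitting_geometric (R : realType) (d : nat -> R) (theta eps : R) :
  0 < theta < 1 -> 0 < eps < d 0%N ->
  (forall k, eps < d k -> d k <= d 0%N -> d k.+1 <= theta * d k) ->
  exists K, [/\ first_index (fun k => (1 <= k)%N /\ d k <= eps) K,
    forall k, (k < K)%N -> eps < d k <= d 0%N
    & K%:R <= 1 + ln (d 0%N / eps) / ln theta^-1].
Proof.
move=> /andP[th0 th1] /andP[e0 ed] step.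
have lth : 0 < ln theta^-1 by rewrite ln_gt0 // invf_gt1.
have d0 : 0 < d 0%N by apply: lt_trans ed.
have lde : 0 < ln (d 0%N / eps) by rewrite ln_gt0 // ltr_pdivlMr // mul1r.
(* The decay hypothesis requires d(k) <= d(0), which the induction recovers from the geometric
   bound. *)
have geo j : (forall i, (1 <= i <= j)%N -> ~ d i <= eps) ->
    eps < d j /\ d j <= theta ^+ j * d 0%N.
  elim: j => [_|j IH h]; first by rewrite mul1r.
  have [|ej dj] := IH.
    by move=> i /andP[i1 ij]; apply: h; rewrite i1 ltnW.
  split; first by rewrite ltNge; apply/negP/h; rewrite leqnn.
  have dj0 : d j <= d 0%N.
    by apply: le_trans dj _; rewrite ler_piMl ?(ltW d0) // exprn_ile1 // ltW.
  apply: le_trans (step j ej dj0) _.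
  by rewrite exprS -mulrA ler_wpM2l // ltW.
have [| |K [hK KT]] := @first_index_le R (fun k => d k <= eps)
    (1 + ln (d 0%N / eps) / ln theta^-1).
- by rewrite lerDl divr_ge0 // ltW.
- move=> j j1 /geo[ej dj].
  rewrite -natr1 addrC lerD2l ler_pdivlMr // mulr_natl -lnXn ?invr_gt0 //.
  rewrite ler_ln ?posrE ?exprn_gt0 ?invr_gt0 ?divr_gt0 //.
  rewrite exprVn ler_pdivlMr // ler_pdivrMl ?exprn_gt0 //.
  by apply: ltW; apply: lt_le_trans ej _.
exists K; split=> // k kK.
have [|ek dk] := geo k.
  move=> i /andP[i1 ik] di; apply: (proj2 hK i); first exact: leq_ltn_trans kK.
  by split.
rewrite ek; apply: le_trans dk _.
by rewrite ler_piMl ?(ltW d0) // exprn_ile1 // ltW.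
Qed.

(** * A uniform bound on the inner counts *)

(** L |xs| contains |A| twice; one copy is replaced by sqrt m times the largest row norm. *)
Lemma Lconst_le_Bfun (R : realType) (m n : nat) (A : 'M[R]_(m, n))
    (xs : 'cV[R]_n) (r : R) :
  (0 < m)%N -> 0 <= r ->
  Lconst A * norm2 xs <= Num.sqrt m%:R * Bfun A xs r.
Proof.
move=> m0 r0.
have S0 := spectral_norm_ge0 A; have x0 := norm2_ge0 xs.
have mR : 0 < m%:R :> R by rewrite ltr0n.
have -> : Lconst A * norm2 xs =
    2 / m%:R * spectral_norm A * norm2 xs * spectral_norm A.
  by rewrite /Lconst; field; rewrite gt_eqF.
have -> : Num.sqrt m%:R * Bfun A xs r = 2 / m%:R * spectral_norm A
    * (norm2 xs + r) * (Num.sqrt m%:R * max_row_norm A).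
  by rewrite /Bfun; ring.
have c0 : 0 <= 2 / m%:R * spectral_norm A by rewrite mulr_ge0 ?divr_ge0 // ltW.
rewrite ler_pM ?mulr_ge0 ?spectral_norm_le_row //.
by rewrite ler_wpM2l // lerDl.
Qed.

(** Delta, the loss and |xs| are unchanged when xs is replaced by -xs, so the nearest solution may
    take the place of [xs]. *)
Lemma step_dichotomy (R : realType) (m n : nat) (A : 'M[R]_(m, n))
    (b : 'cV[R]_m) (xs x z : 'cV[R]_n) (t rho g_L g_H lambda_s : R)
    (lam : 'cV[R]_m) :
  0 < lambda_s ->
  (forall x, lambda_s * Delta xs x <= loss A b x - loss A b xs) ->
  0 < g_L -> g_L <= g_H -> 2 <= lambda_s * g_L -> 0 < rho < 1 / 4 ->
  0 < Delta xs x ->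
  Lconst A * Delta xs x * g_L <= rho / 2 ->
  Delta xs x <= norm2 xs / Num.sqrt (M0const rho) ->
  g_L * Delta xs x <= t -> t <= g_H * Delta xs x -> Lconst A * t <= 1 ->
  `|lam| <= 1 ->
  (HAC A b rho x t z lam ->
     lambda_s * g_L * Delta xs (x + z) <= 6 * rho * Delta xs x) /\
  (~ HAC A b rho x t z lam ->
     rho * t <= 16 * g_H ^+ 2 * (1 + rho) * gap A b x t z lam).
Proof.
move=> ls0 hsharp gL0 gLH gL2 hrho.
have [y hy] := Delta_attained xs x.
have DE w : Delta xs w = Delta y w by case: hy => ->; rewrite ?DeltaN.
have lE : loss A b xs = loss A b y by case: hy => ->; rewrite ?lossN.
have nE : norm2 xs = norm2 y by case: hy => ->; rewrite ?norm2N.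
have {}hsharp w : lambda_s * Delta y w <= loss A b w - loss A b y.
  by rewrite -DE -lE.
rewrite !DE nE => hD D0 hD1 hD2 tl tu Lt1 lam1; split.
  by apply: (@HAC_contraction_near _ _ _ A b y x z t).
by apply: (@gap_lower_near _ _ _ A b y x z t rho g_L g_H lambda_s).
Qed.

Lemma spectral_norm_Bmat_near (R : realType) (m n : nat) (A : 'M[R]_(m, n))
    (xs x : 'cV[R]_n) (r : R) :
  Delta xs x <= r -> spectral_norm (Bmat A x) <= Bfun A xs r.
Proof.
move=> Dr; apply: le_trans (spectral_norm_Bmat_le _ _) _.
rewrite /Bfun ler_wpM2r ?max_row_norm_ge0 // ler_wpM2l //.
  by rewrite mulr_ge0 ?spectral_norm_ge0 // divr_ge0.
have [y hy hD] := Delta_attained xs x.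
have -> : norm2 xs = norm2 y by case: hy => ->; rewrite ?norm2N.
have -> : x = y - (y - x) by rewrite opprB addrCA subrr addr0.
apply: le_trans (norm2B_le _ _) _.
by rewrite lerD2l hD.
Qed.

(** T is the value of j + 1 at which the solver's rate, with the norm of B bounded by B(r), meets
    the lower bound on the gap that holds while (HAC) fails. *)
Lemma inner_bound (R : realType) (m n : nat) (A : 'M[R]_(m, n))
    (b : 'cV[R]_m) (xs x : 'cV[R]_n) (t rho g_L g_H lambda_s C0 : R)
    (z : nat -> 'cV[R]_n) (lam : nat -> 'cV[R]_m)
    (T := M2const A xs C0 lambda_s * (g_H * Num.sqrt ((1 + rho) / rho))) :
  0 < lambda_s ->
  (forall x, lambda_s * Delta xs x <= loss A b x - loss A b xs) ->
  0 < g_L -> g_L <= g_H -> 2 <= lambda_s * g_L -> 0 < rho < 1 / 4 ->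
  0 < Lconst A -> 0 <= C0 -> 1 <= T ->
  0 < Delta xs x ->
  Lconst A * Delta xs x * g_L <= rho / 2 ->
  Delta xs x <= norm2 xs / Num.sqrt (M0const rho) ->
  g_L * Delta xs x <= t -> t <= g_H * Delta xs x -> Lconst A * t <= 1 ->
  solver_output A b C0 x t z lam ->
  exists N, [/\ inner_count A b rho x t z lam N, N%:R <= T
    & lambda_s * g_L * Delta xs (x + z N) <= 6 * rho * Delta xs x].
Proof.
move=> ls0 hsharp gL0 gLH gL2 hrho L0 C00 T1 D0 hD1 hD2 tl tu Lt1 [lam1 hgap].
have /andP[rho0 rho1] := hrho.
have t0 : 0 < t by apply: lt_le_trans tl; rewrite mulr_gt0.
have dich j := step_dichotomy (z j) ls0 hsharp gL0 gLH gL2 hrho D0 hD1 hD2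
  tl tu Lt1 (lam1 j).
set r := lambda_s / (4 * Lconst A).
(* From 2 <= lambda_s g_L and L D g_L <= 1/8 one gets D <= lambda_s / (16 L). *)
have Dr : Delta xs x <= r.
  rewrite /r ler_pdivlMr ?(mulr_gt0 _ L0) //.
  have : 2 * (Lconst A * Delta xs x) <= lambda_s * g_L * (Lconst A * Delta xs x).
    by rewrite ler_wpM2r // mulr_ge0 // ltW.
  have : lambda_s * (Lconst A * Delta xs x * g_L) <= lambda_s * (1 / 8).
    by rewrite ler_wpM2l ?(ltW ls0) //; lra.
  lra.
have S0 := spectral_norm_ge0 (Bmat A x).
have SB : spectral_norm (Bmat A x) ^+ 2 <= Bfun A xs r ^+ 2.
  have h := spectral_norm_Bmat_near A Dr.
  by rewrite ler_pXn2r // nnegrE ?(le_trans S0 h).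
have T2 : T ^+ 2 = 16 * C0 * m%:R * Bfun A xs r ^+ 2 * g_H ^+ 2 * (1 + rho) / rho.
  have e1 : M2const A xs C0 lambda_s ^+ 2 = 16 * C0 * m%:R * Bfun A xs r ^+ 2.
    by rewrite sqr_sqrtr // mulr_ge0 ?sqr_ge0 // !mulr_ge0.
  have e2 : Num.sqrt ((1 + rho) / rho) ^+ 2 = (1 + rho) / rho.
    by rewrite sqr_sqrtr // divr_ge0 //; lra.
  by rewrite /T exprMn [(g_H * _) ^+ 2]exprMn e1 e2; field; rewrite gt_eqF.
have [|N [[[N1 hN] minN] NT]] :=
    @first_index_le R (fun j => HAC A b rho x t (z j) (lam j)) T T1.
  move=> j j1 /(_ j); rewrite j1 leqnn => /(_ isT) /(proj2 (dich j)) h1.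
  rewrite -(@ler_pXn2r _ 2) // ?nnegrE ?(le_trans ler01 T1) // T2.
  rewrite ler_pdivlMr // -(ler_pM2l t0).
  have j0 : 0 < j.+1%:R ^+ 2 :> R by rewrite exprn_gt0.
  have c0 : 0 <= 16 * g_H ^+ 2 * (1 + rho).
    by rewrite !mulr_ge0 ?sqr_ge0 //; lra.
  have c1 : 0 <= t * C0 * m%:R by rewrite !mulr_ge0 // ltW.
  have h2 := hgap j j1; rewrite ler_pdivlMr // in h2.
  have h3 : gap A b x t (z j) (lam j) * j.+1%:R ^+ 2 <= t * C0 * m%:R * Bfun A xs r ^+ 2.
    by apply: le_trans h2 _; rewrite ler_wpM2l.
  have h4 : rho * t * j.+1%:R ^+ 2 <=
      16 * g_H ^+ 2 * (1 + rho) * gap A b x t (z j) (lam j) * j.+1%:R ^+ 2.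
    by rewrite ler_wpM2r // ltW.
  have h5 := ler_wpM2l c0 h3.
  lra.
exists N; split=> //.
exact: (proj1 (dich N)).
Qed.

(** Sharpness against growth gives lambda_s <= (3/2) L |xs| <= (3/2) sqrt m B(r), so lambda_s g_H >=
    2 yields g_H sqrt m B(r) >= 4/3. The remaining factor of the bound is a square root of a number
    at least 1. *)
Lemma inner_bound_ge1 (R : realType) (m n : nat) (A : 'M[R]_(m, n))
    (b : 'cV[R]_m) (xs x : 'cV[R]_n) (rho g_H lambda_s C0 : R) :
  (0 < m)%N -> 0 < lambda_s ->
  lambda_s * Delta xs x <= loss A b x - loss A b xs ->
  0 < Delta xs x <= norm2 xs ->
  2 <= lambda_s * g_H -> 0 < g_H -> 0 < rho -> 2 <= C0 ->
  1 <= M2const A xs C0 lambda_s * (g_H * Num.sqrt ((1 + rho) / rho)).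
Proof.
move=> m0 ls0 hsharp /andP[D0 Dx] gH2 gH0 rho0 C02.
have L0 := Lconst_ge0 A; have x0 := norm2_ge0 xs.
set r := lambda_s / (4 * Lconst A).
have r0 : 0 <= r by exact: divr_ge0 (ltW ls0) (mulr_ge0 (ler0n _ _) L0).
have hl : lambda_s <= 3 / 2 * (Lconst A * norm2 xs).
  rewrite -(ler_pM2r D0); apply: le_trans hsharp _.
  apply: le_trans (loss_growth _ _ _ _) _.
  have : Lconst A * Delta xs x * Delta xs x <= Lconst A * Delta xs x * norm2 xs.
    by rewrite ler_wpM2l // mulr_ge0 ?L0 // ltW.
  lra.
have hB := Lconst_le_Bfun A xs m0 r0; rewrite -/r in hB.
have hg : 1 <= g_H * (Num.sqrt m%:R * Bfun A xs r).
  have h1 := ler_wpM2l (ltW gH0) hl; have h2 := ler_wpM2l (ltW gH0) hB.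
  lra.
have -> : M2const A xs C0 lambda_s * (g_H * Num.sqrt ((1 + rho) / rho)) =
    Num.sqrt (16 * C0 * ((1 + rho) / rho)) * (g_H * (Num.sqrt m%:R * Bfun A xs r)).
  have B0 : 0 <= Bfun A xs r.
    by rewrite /Bfun !mulr_ge0 ?divr_ge0 ?spectral_norm_ge0 ?max_row_norm_ge0 ?addr_ge0.
  have c16 : 0 <= 16 * C0 by lra.
  have e1 : M2const A xs C0 lambda_s =
      Num.sqrt (16 * C0) * Num.sqrt m%:R * Bfun A xs r.
    rewrite /M2const -/r sqrtrM; last by rewrite mulr_ge0.
    by rewrite (sqrtrM _ c16) sqrtr_sqr ger0_norm.
  by rewrite e1 (sqrtrM ((1 + rho) / rho) c16); ring.
apply: mulr_ege1 => //.
rewrite -[leLHS]sqrtr1 ler_wsqrtr //.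
have : 1 <= (1 + rho) / rho by rewrite ler_pdivlMr //; lra.
nra.
Qed.

(** * Assembling the outer and inner counts *)

Theorem theorem6p8 (R : realType) (m n : nat) (A : 'M[R]_(m, n))
    (xs : 'cV[R]_n) (b : 'cV[R]_m) (I1 I2 : {set 'I_m})
    (hcover : forall i, (i \in I1) || (i \in I2))
    (hdisj : [disjoint I1 & I2])
    (hb0 : forall i, 0 <= b i 0)
    (hb : forall i, i \in I1 -> b i 0 = (A *m xs) i 0 ^+ 2)
    (lambda_s : R) (hlambda : 0 < lambda_s)
    (hsharp : forall x, lambda_s * Delta xs x <= loss A b x - loss A b xs)
    (p : R) (hp : 0 < p < 1) (q : nat) (hq0 : (0 < q)%N)
    (hq : m%:R * p = q%:R)
    (u_L u_H : R) (hu_L : 0 < u_L) (hu_H : 0 < u_H)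
    (hr : forall x,
       u_L * (loss A b x - loss A b xs) <= order_stat A b q x
         <= u_H * (loss A b x - loss A b xs))
    (G : R) (hG : 0 < G)
    (g_L g_H : R) (hg_L : g_L = G * lambda_s * u_L)
    (hg_H : g_H = 3 / 2 * G * Lconst A * norm2 xs * u_H)
    (hgLH : g_L <= g_H) (hgL2 : 2 / lambda_s <= g_L)
    (rho : R) (hrho : 0 < rho < 1 / 4) (C0 : R) (hC0 : 2 <= C0)
    (x : nat -> 'cV[R]_n) (t : nat -> R)
    (z : nat -> nat -> 'cV[R]_n) (lam : nat -> nat -> 'cV[R]_m)
    (ht : forall k,
       t k = Num.min (Lconst A)^-1 (G * order_stat A b q (x k)))
    (hrun : adaIPL_run A b C0 rho x t z lam)
    (hx01 : Delta xs (x 0%N) <= rho / (2 * Lconst A * g_L))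
    (hx02 : Delta xs (x 0%N) <= norm2 xs / Num.sqrt (M0const rho))
    (hx03 : Delta xs (x 0%N) <= 1 / (g_H * Lconst A))
    (eps : R) (heps : 0 < eps < Delta xs (x 0%N)) :
  total_inner_le A b rho xs x t z lam eps
    (M2const A xs C0 lambda_s
     * (g_H * Num.sqrt ((1 + rho) / rho)
        * ln (lambda_s * Delta xs (x 0%N) * g_L / (6 * rho) * (1 / eps)))
     / ln (lambda_s * g_L / (6 * rho))).
Proof.
move: heps; set d0 := Delta xs (x 0%N) => /andP[eps0 epsd].
have d00 : 0 < d0 by apply: lt_trans epsd.
have /andP[rho0 rho1] := hrho.
have /andP[p0 p1] := hp.
have m0 : (0 < m)%N.
  case: (posnP m) => // m0; move: hq hq0; rewrite m0 mul0r => /esym/eqP.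
  by rewrite pnatr_eq0 => /eqP ->.
have gL0 : 0 < g_L by rewrite hg_L !mulr_gt0.
have gH0 : 0 < g_H by apply: lt_le_trans hgLH.
(* If L were 0, the quotient in [hx01] would be 0 because the inverse of 0 is 0, contradicting d0 >
   0. *)
have L0 : 0 < Lconst A.
  rewrite lt_neqAle Lconst_ge0 andbT eq_sym; apply/eqP => LE.
  by move: hx01; rewrite LE mulr0 mul0r invr0 mulr0 leNgt d00.
have gL2 : 2 <= lambda_s * g_L by rewrite mulrC -ler_pdivrMr.
have gH2 : 2 <= lambda_s * g_H.
  by apply: le_trans gL2 _; rewrite ler_wpM2l // ltW.
have hD1 : Lconst A * d0 * g_L <= rho / 2.
  move: hx01; rewrite ler_pdivlMr ?(mulr_gt0 _ gL0) ?(mulr_gt0 _ L0) // -/d0; lra.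
have hD3 : g_H * Lconst A * d0 <= 1.
  by move: hx03; rewrite ler_pdivlMr ?(mulr_gt0 gH0 L0) // mulrC.
have d0xs : d0 <= norm2 xs.
  have [_ _ M01] := M0const_bounds hrho.
  apply: le_trans hx02 _; rewrite ler_pdivrMr ?sqrtr_gt0 ?(lt_le_trans ltr01) //.
  by rewrite ler_peMr ?norm2_ge0 // -[leLHS]sqrtr1 ler_wsqrtr.
set T := M2const A xs C0 lambda_s * (g_H * Num.sqrt ((1 + rho) / rho)).
have T1 : 1 <= T.
  apply: (@inner_bound_ge1 _ _ _ A b xs (x 0%N)) => //.
  by rewrite d00 d0xs.
(* The contraction factor; it is below 1 because 6 rho < 3/2 < 2 <= lambda_s g_L. *)
pose theta := 6 * rho / (lambda_s * g_L).
have k0 : 0 < lambda_s * g_L by rewrite mulr_gt0.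
have th01 : 0 < theta < 1.
  rewrite divr_gt0 ?mulr_gt0 //= ltr_pdivrMr // mul1r; lra.
have step k : eps < Delta xs (x k) -> Delta xs (x k) <= d0 ->
    exists N, [/\ inner_count A b rho (x k) (t k) (z k) (lam k) N, N%:R <= T
      & Delta xs (x k.+1) <= theta * Delta xs (x k)].
  move=> ek kd.
  have D0 : 0 < Delta xs (x k) by apply: lt_trans ek.
  (* Ensures g_L D <= t also when the minimum defining t is 1/L. *)
  have gd : g_H * Delta xs (x k) <= (Lconst A)^-1.
    rewrite -[leRHS]mul1r ler_pdivlMr // mulrAC; apply: le_trans hD3.
    by rewrite ler_wpM2l ?(ltW (mulr_gt0 gH0 L0)).
  have growth : loss A b (x k) - loss A b xs
      <= 3 / 2 * Lconst A * norm2 xs * Delta xs (x k).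
    apply: le_trans (loss_growth _ _ _ _) _.
    have : Lconst A * Delta xs (x k) * Delta xs (x k)
        <= Lconst A * Delta xs (x k) * norm2 xs.
      by rewrite ler_wpM2l ?(le_trans kd) ?(ltW (mulr_gt0 L0 D0)).
    lra.
  have /andP[rl ru] := hr (x k).
  have tl : g_L * Delta xs (x k) <= t k.
    rewrite ht le_min; apply/andP; split.
      by apply: le_trans gd; rewrite ler_wpM2r // ltW.
    rewrite hg_L -!mulrA ler_wpM2l ?(ltW hG) //; apply: le_trans rl.
    by rewrite mulrCA ler_wpM2l // ltW.
  have tu : t k <= g_H * Delta xs (x k).
    rewrite ht ge_min; apply/orP; right.
    have -> : g_H * Delta xs (x k) =
        G * (u_H * (3 / 2 * Lconst A * norm2 xs * Delta xs (x k))).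
      by rewrite hg_H; ring.
    rewrite ler_wpM2l ?(ltW hG) //; apply: le_trans ru _.
    by rewrite ler_wpM2l // ltW.
  have Lt : Lconst A * t k <= 1.
    by rewrite -ler_pdivlMl // mulr1 ht ge_min lexx.
  have hD1k : Lconst A * Delta xs (x k) * g_L <= rho / 2.
    by apply: le_trans hD1; rewrite ler_wpM2r ?(ltW gL0) // ler_wpM2l // ltW.
  have hD2k := le_trans kd hx02.
  have tk0 : 0 < t k by apply: lt_le_trans tl; rewrite mulr_gt0.
  have [hsolver hnext] := hrun k.
  have C00 : 0 <= C0 by lra.
  have [N [hN NT hc]] := inner_bound hlambda hsharp gL0 hgLH gL2 hrho L0 C00
    T1 D0 hD1k hD2k tl tu Lt (hsolver tk0).
  exists N; split=> //; rewrite (hnext N hN) /theta.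
  by rewrite mulrAC ler_pdivlMr // mulrC.
have epsd' : 0 < eps < Delta xs (x 0%N) by rewrite eps0.
have [|K [hK Kd Kle]] :=
    @hitting_geometric R (fun k => Delta xs (x k)) theta eps th01 epsd'.
  by move=> k ek kd; have [N []] := step k ek kd.
(* Only k < K matters; other indices receive the dummy count 0. *)
have /choice[N hN] : forall k, exists N, (k < K)%N ->
    inner_count A b rho (x k) (t k) (z k) (lam k) N /\ N%:R <= T.
  move=> k; case: (ltnP k K) => kK; last by exists 0%N.
  by have /andP[ek kd] := Kd k kK; have [N [? ? _]] := step k ek kd; exists N.
exists K, N; split=> // [k /hN[]//|].
have thE : lambda_s * g_L / (6 * rho) = theta^-1 by rewrite invf_div.
have -> : lambda_s * d0 * g_L / (6 * rho) * (1 / eps) = theta^-1 * (d0 / eps).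
  by rewrite -thE; field; rewrite !gt_eqF.
have lth : 0 < ln theta^-1.
  by case/andP: th01 => th0 th1; rewrite ln_gt0 // invf_gt1.
rewrite thE lnM ?posrE ?invr_gt0 ?divr_gt0 ?mulr_gt0 //.
(* The claimed bound is exactly the inner bound T times the bound on K from [hitting_geometric]. *)
have -> : M2const A xs C0 lambda_s *
    (g_H * Num.sqrt ((1 + rho) / rho) * (ln theta^-1 + ln (d0 / eps))) / ln theta^-1
    = T * (1 + ln (d0 / eps) / ln theta^-1).
  by rewrite /T; field; rewrite gt_eqF.
rewrite natr_sum; apply: (@le_trans _ _ (\sum_(k < K) T)).
  by apply: ler_sum => k _; have [] := hN k (ltn_ord k).
rewrite sumr_const card_ord -mulr_natr ler_wpM2l ?(le_trans ler01 T1) //.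
Qed.
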